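(* Let $R$ be a ring of type (A). Fix a decomposition $Q_{l,cl}(R)=\prod_{i=1}^n R_i$ where the $R_i$ are local rings with $\mathrm{rad}(R_i)=\mathcal{N}_{R_i}$, and for $r\in R$ let $\frac{r}{1}\in R_i$ denote the image of $r$ under $R\to Q_{l,cl}(R)\to R_i$. Then 1. $\mathrm{max.Den}_l(R)=\{S_1,\ldots,S_n\}$ where $S_i=\{r\in R: \frac{r}{1}\in R_i^*\}$. 2. $\mathcal{C}_R=\mathcal{C}_l(R)$, i.e. $\mathcal{C}_R=\bigcap_{S\in\mathrm{max.Den}_l(R)}S$. 3. $\mathrm{Nil}(R)=\mathcal{N}_R$. 4. $Q:=Q_{l,cl}(R)=Q_l(R)$ is a weakly left localizable ring with $\mathrm{Nil}(Q)=\mathcal{N}_Q=\mathrm{rad}(Q)$. 5. $\mathcal{C}_R^{-1}\mathcal{N}_R=\mathcal{N}_Q=\mathrm{rad}(Q)$ and $\mathcal{N}_R=R\cap\mathcal{N}_Q$. 6. $\mathcal{C}_R^{-1}\mathcal{L}_l(R)=\mathcal{L}_l(Q)$ and $\mathcal{L}_l(R)=R\cap\mathcal{L}_l(Q)$.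
   Context: All rings are associative with $1\neq 0$; ideals are two-sided. For a ring $R$: $R^*$ is the group of units, $\mathcal{C}_R$ is the set of (left and right) regular elements, i.e. non-zero-divisors, $\mathrm{rad}(R)$ is the Jacobson radical, $\mathrm{Nil}(R)$ is the set of nilpotent elements, and $\mathcal{N}_R$ is the nil radical, i.e. the sum of all nil ideals of $R$. A ring $R$ is local if $R\setminus R^*$ is an ideal of $R$. A subset $S\subseteq R$ closed under multiplication with $1\in S$, $0\notin S$ is a left Ore set if $Sr\cap Rs\neq\emptyset$ for all $r\in R$, $s\in S$; then $\mathrm{ass}(S):=\{r\in R: sr=0\text{ for some }s\in S\}$ is an ideal. A left Ore set $S$ is a left denominator set if $rs=0$ with $r\in R$, $s\in S$ implies $tr=0$ for some $t\in S$. For a left denominator set $S$, $S^{-1}R=\{s^{-1}r: s\in S,r\in R\}$ is the left localization of $R$ at $S$. $\mathrm{max.Den}_l(R)$ is the (non-empty) set of maximal elements, with respect to inclusion, of the set of left denominator sets of $R$. $\mathfrak{l}_R:=\bigcap_{S\in \mathrm{max.Den}_l(R)}\mathrm{ass}(S)$. $\mathcal{C}_l(R):=\bigcap_{S\in\mathrm{max.Den}_l(R)}S$ is the set of completely left localizable elements. $Q_{l,cl}(R):=\mathcal{C}_R^{-1}R$ is the classical left quotient ring; it exists iff $\mathcal{C}_R$ is a left Ore set. $S_{l,0}(R)$ is the largest left denominator set with $\mathrm{ass}=0$ (it exists), and $Q_l(R):=S_{l,0}(R)^{-1}R$. For a subset $X\subseteq R$, $\mathcal{C}_R^{-1}X:=\{c^{-1}x: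 c\in\mathcal{C}_R,x\in X\}$; $R$ is identified with its image in $Q$. An element of $R$ is left localizable if it belongs to some left denominator set of $R$; $\mathcal{L}_l(R)$ is the set of left localizable elements. $R$ is weakly left localizable if every non-nilpotent element of $R$ is left localizable. For ideals $\mathfrak a,\mathfrak b$ of $R$, ''$\mathfrak a$ is a nil ideal modulo $\mathfrak b$'' means that $(\mathfrak a+\mathfrak b)/\mathfrak b$ is a nil ideal of $R/\mathfrak b$. A ring $R$ is of type (A) if it satisfies one of the following three conditions (which are equivalent to each other): (1) $R$ is weakly left localizable, $\mathfrak{l}_R=0$, $|\mathrm{max.Den}_l(R)|<\infty$, $S^{-1}R$ is weakly left localizable for every $S\in\mathrm{max.Den}_l(R)$, and for all distinct $S,T\in\mathrm{max.Den}_l(R)$, $\mathrm{ass}(S)$ is not a nil ideal modulo $\mathrm{ass}(T)$; (2) $Q_{l,cl}(R)$ exists and $Q_{l,cl}(R)\simeq\prod_{i=1}^nR_i$ ($n\ge1$) where the $R_i$ are local rings with $\mathrm{rad}(R_i)=\mathcal{N}_{R_i}$; (3) $Q_l(R)\simeq\prod_{i=1}^nR_i$ ($n\ge1$) where the $R_i$ are local rings with $\mathrm{rad}(R_i)=\mathcal{N}_{R_i}$. *)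

(* Defs.v *)
From HB Require Import structures.
From mathcomp Require Import all_boot all_order all_algebra.
From mathcomp Require Import all_classical.
Set Implicit Arguments.
Unset Strict Implicit.
Unset Printing Implicit Defensive.
Import GRing.Theory.
Local Open Scope classical_set_scope.
Local Open Scope ring_scope.

(* Rings are [nzRingType]: associative, unital, 1 != 0, not necessarily        *)
(* commutative.  Subsets are classical sets.                                   *)

Section Rings.
Variable R : nzRingType.
Implicit Types (I J : set R) (x y r s t : R).

(* [GRing.unit] is not available: an [nzRingType] carries no inverse function. *)
Definition is_inverse x y : Prop := x * y = 1 /\ y * x = 1.

Definition units : set R := [set x | exists y, is_inverse x y].

Definition regulars : set R := [set x | GRing.lreg x /\ GRing.rreg x].

Definition nilpotents : set R := [set x | exists n : nat, x ^+ n = 0].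

Definition left_ideal I : Prop :=
  [/\ I 0, forall x y, I x -> I y -> I (x + y) & forall r x, I x -> I (r * x)].

Definition ideal I : Prop := left_ideal I /\ forall r x, I x -> I (x * r).

Definition nil_ideal I : Prop := ideal I /\ I `<=` nilpotents.

(* The sum of all nil ideals: finite sums of elements of nil ideals. *)
Definition nil_radical : set R :=
  [set x | exists s : seq R,
     (forall y, y \in s -> exists2 I, nil_ideal I & I y) /\
     x = \sum_(y <- s) y].

Definition maximal_left_ideal I : Prop :=
  [/\ left_ideal I, I <> setT &
      forall J, left_ideal J -> I `<=` J -> J = I \/ J = setT].

Definition jacobson_radical : set R :=
  \bigcap_(I in maximal_left_ideal) I.

Definition local_ring : Prop := ideal (~` units).

(* (I + J) / J is nil in R / J; the class of z is nilpotent iff some power of  *)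
(* z lies in J.                                                                *)
Definition nil_modulo I J : Prop :=
  forall x y, I x -> J y -> exists n : nat, J ((x + y) ^+ n).

Definition multiplicative_set (S : set R) : Prop :=
  [/\ S 1, ~ S 0 & forall s t, S s -> S t -> S (s * t)].

Definition left_Ore_set (S : set R) : Prop :=
  multiplicative_set S /\
  forall r s, S s -> exists s' r', S s' /\ s' * r = r' * s.

Definition ass (S : set R) : set R := [set r | exists2 s, S s & s * r = 0].

Definition left_denominator_set (S : set R) : Prop :=
  left_Ore_set S /\
  forall r s, S s -> r * s = 0 -> exists2 t, S t & t * r = 0.

Definition max_Den : set (set R) :=
  [set S | left_denominator_set S /\
           forall T, left_denominator_set T -> S `<=` T -> T = S].

Definition l_radical : set R := \bigcap_(S in max_Den) ass S.

Definition completely_left_localizable : set R := \bigcap_(S in max_Den) S.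

Definition left_localizable : set R :=
  [set r | exists2 S, left_denominator_set S & S r].

Definition weakly_left_localizable : Prop :=
  forall r, ~ nilpotents r -> left_localizable r.

(* [is_Sl0 S]: S is the largest left denominator set with ass(S) = 0. *)
Definition is_Sl0 (S : set R) : Prop :=
  [/\ left_denominator_set S, ass S = [set 0] &
      forall T, left_denominator_set T -> ass T = [set 0] -> T `<=` S].

End Rings.

Arguments units : clear implicits.
Arguments regulars : clear implicits.
Arguments nilpotents : clear implicits.
Arguments nil_radical : clear implicits.
Arguments jacobson_radical : clear implicits.
Arguments local_ring : clear implicits.
Arguments max_Den : clear implicits.
Arguments l_radical : clear implicits.
Arguments completely_left_localizable : clear implicits.
Arguments left_localizable : clear implicits.
Arguments weakly_left_localizable : clear implicits.

Section Localization.
Variables (R Q : nzRingType) (f : {rmorphism R -> Q}).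

(* S^-1 X = { f(s)^-1 f(x) : s in S, x in X } *)
Definition fractions (S X : set R) : set Q :=
  [set q | exists s x u, [/\ S s, X x, is_inverse (f s) u & q = u * f x]].

(* f : R -> Q is the left localization R -> S^-1 R.  These three properties    *)
(* determine (Q, f) up to a unique isomorphism under R, so the localization is *)
(* handled through them rather than through one particular construction.       *)
Definition is_left_localization (S : set R) : Prop :=
  left_denominator_set S /\
  [/\ forall s, S s -> units Q (f s),
      forall r, f r = 0 <-> ass S r &
      fractions S setT = setT].

(* Q_{l,cl}(R); in particular it exists, since the regular elements are then   *)
(* a left Ore set.                                                             *)
Definition is_Qlcl : Prop := is_left_localization (regulars R).

Definition is_Ql : Prop := exists2 S, is_Sl0 S & is_left_localization S.

End Localization.

(* The projections [p i] identify the ring Q with the product of the R_i. *)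
Definition is_ring_product (Q : nzRingType) (n : nat) (Ri : 'I_n -> nzRingType)
    (p : forall i, {rmorphism Q -> Ri i}) : Prop :=
  bijective (fun (q : Q) (i : 'I_n) => p i q).

Definition local_nil_decomposition (Q : nzRingType) (n : nat)
    (Ri : 'I_n -> nzRingType) (p : forall i, {rmorphism Q -> Ri i}) : Prop :=
  [/\ (0 < n)%N, is_ring_product p &
      forall i, local_ring (Ri i) /\
                jacobson_radical (Ri i) = nil_radical (Ri i)].

Definition typeA1 (R : nzRingType) : Prop :=
  [/\ weakly_left_localizable R,
      l_radical R = [set 0],
      finite_set (max_Den R),
      forall S, max_Den R S ->
        exists (Q : nzRingType) (f : {rmorphism R -> Q}),
          is_left_localization f S /\ weakly_left_localizable Q &
      forall S T, max_Den R S -> max_Den R T -> S <> T ->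
        ~ nil_modulo (ass S) (ass T)].

Definition typeA2 (R : nzRingType) : Prop :=
  exists (Q : nzRingType) (f : {rmorphism R -> Q}), is_Qlcl f /\
  exists (n : nat) (Ri : 'I_n -> nzRingType)
         (p : forall i, {rmorphism Q -> Ri i}), local_nil_decomposition p.

Definition typeA3 (R : nzRingType) : Prop :=
  exists (Q : nzRingType) (f : {rmorphism R -> Q}), is_Ql f /\
  exists (n : nat) (Ri : 'I_n -> nzRingType)
         (p : forall i, {rmorphism Q -> Ri i}), local_nil_decomposition p.

Definition typeA (R : nzRingType) : Prop := [\/ typeA1 R, typeA2 R | typeA3 R].

(* Main.v *)
(* Every element of a local ring R_i with rad(R_i) nil is a unit or nilpotent.
   A multiplicative set of R containing, for every i, some r whose image in R_i
   is not a unit contains, after taking powers, elements vanishing in each R_i,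
   hence their product 0; so each left denominator set lies in some S_i.
   Conversely S_i is a left denominator set: write the i-th central idempotent
   of Q as a fraction c^-1 a; then a lies in S_i and vanishes in the other
   factors.  This only uses that f : R -> Q is injective and that every element
   of Q is a fraction over R with denominator invertible in Q, so it applies to
   the identity of Q as well. *)

Require Import Defs.
From HB Require Import structures.
From mathcomp Require Import all_boot all_order all_algebra.
From mathcomp Require Import all_classical.
Set Implicit Arguments.
Unset Strict Implicit.
Unset Printing Implicit Defensive.
Import GRing.Theory.
Local Open Scope classical_set_scope.
Local Open Scope ring_scope.

(** * Units against nilpotents and left ideals *)

Section Units.
Variable R : nzRingType.
Implicit Types x y u : R.

Lemma units1 : units R 1.
Proof. by exists 1; split; rewrite mulr1. Qed.

Lemma unitsM x y : units R x -> units R y -> units R (x * y).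
Proof.
move=> [x' [xx' x'x]] [y' [yy' y'y]]; exists (y' * x'); split.
  by rewrite mulrA -(mulrA x) yy' mulr1.
by rewrite mulrA -(mulrA y') x'x mulr1.
Qed.

Lemma inverse_units x y : is_inverse x y -> units R y.
Proof. by case=> xy yx; exists x. Qed.

Lemma units_nilpotentF x : units R x -> ~ nilpotents R x.
Proof.
move=> [y [xy yx]] [k xk].
have xyk m : x ^+ m * y ^+ m = 1.
  elim: m => [|m IH]; first by rewrite !expr0 mulr1.
  by rewrite exprSr exprS mulrA -(mulrA _ x y) xy mulr1.
by have := xyk k; rewrite xk mul0r => /esym/eqP; rewrite oner_eq0.
Qed.

Lemma units_sub_nilpotent x : nilpotents R x -> units R (1 - x).
Proof.
move=> [k xk]; exists (\sum_(i < k) x ^+ i).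
have geom : (1 - x) * (\sum_(i < k) x ^+ i) = 1.
  by have /(congr1 -%R) := subrX1 x k; rewrite xk sub0r opprK -mulNr opprB.
split=> //; rewrite -[RHS]geom; apply/esym/commr_sum => i _.
by apply/commrX/commr_sym/commrB; [exact: commr1 | exact: commr_refl].
Qed.

Lemma left_ideal_unit (I : set R) u : left_ideal I -> units R u -> I u -> I = setT.
Proof.
move=> [_ _ IM] [v [_ vu]] Iu; apply/seteqP; split=> // x _.
by rewrite -(mulr1 x) -vu mulrA; apply: IM.
Qed.

End Units.

(** * Nil ideals and the nil radical *)

Section NilIdeals.
Variable R : nzRingType.
Implicit Types I J : set R.

Lemma nil_ideal0 : @nil_ideal R [set 0].
Proof.
split; last by move=> x ->; exists 1%N; rewrite expr1.
split; last by move=> r x ->; rewrite /= mul0r.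
by split=> [|x y -> ->|r x ->] //=; rewrite ?addr0 ?mulr0.
Qed.

(* Modulo J, the power (x + y) ^+ k is x ^+ k = 0. *)
Lemma nil_idealD I J : nil_ideal I -> nil_ideal J ->
  nil_ideal [set z | exists x y, [/\ I x, J y & z = x + y]].
Proof.
move=> [[[I0 ID IMl] IMr] Inil] [[[J0 JD JMl] JMr] Jnil]; split.
  split; first split.
  - by exists 0, 0; rewrite addr0.
  - move=> _ _ [x [y [Ix Jy ->]]] [x' [y' [Ix' Jy' ->]]].
    by exists (x + x'), (y + y'); rewrite addrACA; split; [exact: ID|exact: JD|].
  - move=> r _ [x [y [Ix Jy ->]]].
    by exists (r * x), (r * y); rewrite mulrDr; split; [exact: IMl|exact: JMl|].
  - move=> r _ [x [y [Ix Jy ->]]].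
    by exists (x * r), (y * r); rewrite mulrDl; split; [exact: IMr|exact: JMr|].
move=> _ [x [y [Ix Jy ->]]]; have [k xk] := Inil x Ix.
have powD m : exists2 z, J z & (x + y) ^+ m = x ^+ m + z.
  elim: m => [|m [z Jz e]]; first by exists 0; rewrite ?addr0.
  exists (y * x ^+ m + (x + y) * z).
    by apply: JD; [exact: JMr | exact: JMl].
  by rewrite exprS e mulrDr {1}mulrDl -exprS addrA.
have [z Jz e] := powD k; have [l zl] := Jnil z Jz.
by exists (k * l)%N; rewrite exprM e xk add0r.
Qed.

(** Since two nil ideals have a nil sum, induction on the number of summands puts a finite sum
    inside a single nil ideal. *)
Lemma nil_radical_nil : nil_radical R `<=` nilpotents R.
Proof.
move=> _ [s [+ ->]] => sP.
suff [I [_ Inil]] : exists2 I, nil_ideal I & I (\sum_(y <- s) y).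
  exact: Inil.
elim: s sP => [_|a s IHs sP].
  by exists [set 0]; [exact: nil_ideal0 | rewrite big_nil].
have [I nI Ia] := sP a (mem_head _ _).
have [J nJ Js] := IHs (fun y ys => sP y (mem_behead (s := a :: s) ys)).
exists [set z | exists x y, [/\ I x, J y & z = x + y]]; first exact: nil_idealD.
by exists a, (\sum_(y <- s) y); rewrite big_cons.
Qed.

Lemma nil_ideal_sub_radical I : nil_ideal I -> I `<=` nil_radical R.
Proof.
move=> nI x Ix; exists [:: x]; split; last by rewrite big_seq1.
by move=> y; rewrite inE => /eqP ->; exists I.
Qed.

Lemma nil_radicalE : ideal (nilpotents R) -> nil_radical R = nilpotents R.
Proof.
move=> idN; apply/seteqP; split; first exact: nil_radical_nil.
by apply: nil_ideal_sub_radical; split.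
Qed.

End NilIdeals.

(** * Local rings *)

Lemma local_jacobson (A : nzRingType) :
  local_ring A -> jacobson_radical A = ~` units A.
Proof.
move=> [lU _].
(* A proper left ideal contains no unit, so it lies in the left ideal of nonunits; maximality forces
   equality. *)
have max_eq M : maximal_left_ideal M -> M = ~` units A.
  move=> [lM MT Mmax].
  have MU : M `<=` ~` units A.
    by move=> x Mx ux; apply: MT; exact: left_ideal_unit ux Mx.
  case: (Mmax _ lU MU) => // UT.
  by have : (~` units A) 1 by [rewrite UT]; case; exact: units1.
apply/seteqP; split=> [x|x nUx M /max_eq -> //].
apply; split=> // [UT|J lJ UJ].
  by have : (~` units A) 1 by [rewrite UT]; case; exact: units1.
have [[y [Jy uy]]|H] := pselect (exists y, J y /\ units A y).
  by right; exact: left_ideal_unit uy Jy.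
left; apply/seteqP; split=> // y Jy uy; apply: H; by exists y.
Qed.

Lemma local_nil_nonunit (A : nzRingType) (x : A) :
  local_ring A -> jacobson_radical A = nil_radical A ->
  ~ units A x -> nilpotents A x.
Proof.
by move=> /local_jacobson -> UE Ux; apply: nil_radical_nil; rewrite -UE.
Qed.

(** * Finite products of local rings with nil Jacobson radical *)

Section Product.
Variables (Q : nzRingType) (n : nat) (Ri : 'I_n -> nzRingType).
Variable p : forall i, {rmorphism Q -> Ri i}.
Hypothesis pP : is_ring_product p.

Lemma product_inj x y : (forall i, p i x = p i y) -> x = y.
Proof.
move=> pxy; apply: (bij_inj pP).
exact/functional_extensionality_dep.
Qed.

Lemma product_lift (a : forall i, Ri i) : exists q, forall i, p i q = a i.
Proof.
have [g _ gK] := pP; exists (g a) => i.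
exact: (congr1 (fun h : forall i, Ri i => h i) (gK a)).
Qed.

Lemma product_proj_surj i (x : Ri i) : exists q, p i q = x.
Proof.
have [q pq] := product_lift (dfwith (fun j => 0 : Ri j) i x).
by exists q; rewrite pq dfwithin.
Qed.

Lemma product_idem i :
  exists e, [/\ p i e = 1, forall j, j != i -> p j e = 0 &
                forall q, e * q = q * e].
Proof.
have [e pe] := product_lift (fun j => (j == i)%:R).
exists e; split=> [|j /negbTE ji|q]; rewrite ?pe ?eqxx ?ji //.
apply: product_inj => j; rewrite !rmorphM !pe.
by case: (j == i); rewrite ?(mulr1, mul1r, mulr0, mul0r).
Qed.

Lemma units_product q : (forall i, units (Ri i) (p i q)) -> units Q q.
Proof.
move=> H; have [u pu] := product_lift (fun i => projT1 (cid (H i))).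
exists u; split; apply: product_inj => i; rewrite rmorphM pu rmorph1;
  by case: cid => v [].
Qed.

Lemma units_proj q i : units Q q -> units (Ri i) (p i q).
Proof.
move=> [u [qu uq]].
by exists (p i u); split; rewrite -rmorphM ?qu ?uq rmorph1.
Qed.

Lemma nilpotents_product q :
  nilpotents Q q <-> forall i, nilpotents (Ri i) (p i q).
Proof.
split=> [[k qk] i|/(_ _)/cid H]; first by exists k; rewrite -rmorphXn qk rmorph0.
(* The sum of the exponents of all factors is an exponent that works in every factor at once. *)
exists (\sum_i projT1 (H i))%N; apply: product_inj => i.
rewrite rmorphXn rmorph0 (bigD1 i) //= exprD.
by case: (H i) => k /= ->; rewrite mul0r.
Qed.

Hypothesis loc : forall i, local_ring (Ri i) /\
  jacobson_radical (Ri i) = nil_radical (Ri i).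

Lemma factor_nonunit i (x : Ri i) : ~ units (Ri i) x -> nilpotents (Ri i) x.
Proof. by have [li ji] := loc i; apply: local_nil_nonunit. Qed.

(** In each factor the nilpotents are exactly the nonunits, and these form an ideal; closure
    properties of the nilpotents of [Q] are thus checked factor by factor. *)
Lemma nilpotents_productE q :
  nilpotents Q q <-> forall i, ~ units (Ri i) (p i q).
Proof.
rewrite nilpotents_product; split=> H i.
  by move=> /units_nilpotentF; apply.
exact: factor_nonunit.
Qed.

Lemma ideal_nilpotents_product : ideal (nilpotents Q).
Proof.
split; first split.
- by exists 1%N; rewrite expr1.
- move=> x y /nilpotents_productE Nx /nilpotents_productE Ny.
  apply/nilpotents_productE => i; rewrite rmorphD.
  by have [[[_ UD _] _] _] := loc i; apply: UD; [exact: Nx | exact: Ny].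
- move=> r x /nilpotents_productE Nx; apply/nilpotents_productE => i.
  by rewrite rmorphM; have [[[_ _ UM] _] _] := loc i; apply: UM; exact: Nx.
- move=> x r /nilpotents_productE Nx; apply/nilpotents_productE => i.
  by rewrite rmorphM; have [[_ UM] _] := loc i; apply: UM; exact: Nx.
Qed.

Lemma maximal_nonunit_proj i :
  maximal_left_ideal [set q | ~ units (Ri i) (p i q)].
Proof.
have [[[U0 UD UM] _] _] := loc i.
have lU : left_ideal [set q | ~ units (Ri i) (p i q)].
  split=> [|x y nx ny|r x nx] /=.
  - by rewrite rmorph0.
  - by rewrite rmorphD; exact: UD.
  - by rewrite rmorphM; exact: UM.
split=> // [/seteqP[_ /(_ 1 I)]|J lJ UJ] /=.
  by rewrite rmorph1; apply; exact: units1.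
have [[q [Jq [v [qv vq]]]]|H] := pselect (exists q, J q /\ units (Ri i) (p i q)).
  (* With [w] lifting the inverse of the [i]-th coordinate of [q], the element [1 - w * q] vanishes
     in factor [i], hence lies in [J]; so [1] does too. *)
  right; have [w pw] := product_proj_surj v.
  have [_ JD JM] := lJ; apply: (left_ideal_unit lJ (units1 _)).
  rewrite -(subrK (w * q) 1); apply: JD; last exact: JM.
  apply: UJ => /=; rewrite rmorphB rmorphM pw vq rmorph1 subrr; exact: U0.
left; apply/seteqP; split=> // q Jq uq; apply: H; by exists q.
Qed.

(** An element of every maximal left ideal is a nonunit in each factor, hence nilpotent. Conversely,
    if a nilpotent [q] were outside a maximal [M], then [1 = m + r * q] with [m] in [M]; nilpotents
    form an ideal, so [m = 1 - r * q] would be a unit. *)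
Lemma jacobson_productE : jacobson_radical Q = nilpotents Q.
Proof.
have [[N0 ND NM] NMr] := ideal_nilpotents_product.
apply/seteqP; split=> [q Jq|q Nq M [lM MT Mmax]].
  by apply/nilpotents_productE => i; exact: (Jq _ (maximal_nonunit_proj i)).
have [M0 MD MM] := lM.
pose J := [set y | exists m r, M m /\ y = m + r * q].
have MJ : M `<=` J by move=> m Mm; exists m, 0; rewrite mul0r addr0.
have lJ : left_ideal J.
  split=> [|_ _ [m [r [Mm ->]]] [m' [r' [Mm' ->]]]|t _ [m [r [Mm ->]]]].
  - exact: MJ.
  - by exists (m + m'), (r + r'); rewrite mulrDl addrACA; split=> //; exact: MD.
  - by exists (t * m), (t * r); rewrite mulrDr mulrA; split=> //; exact: MM.
have [JM|JT] := Mmax J lJ MJ.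
  by rewrite -JM; exists 0, 1; rewrite mul1r add0r.
have [m [r [Mm e]]] : J 1 by rewrite JT.
have um : units Q m.
  by rewrite -(addrK (r * q) m) -e; apply: units_sub_nilpotent; exact: NM.
by case: MT; exact: left_ideal_unit um Mm.
Qed.

(** * Left denominator sets of a subring whose fractions fill the product *)

Variables (R : nzRingType) (f : {rmorphism R -> Q}).
Hypothesis f_inj : injective f.
Hypothesis fracP : forall q, exists c a, units Q (f c) /\ f c * q = f a.

Definition unit_preimage i : set R := [set r | units (Ri i) (p i (f r))].

Lemma unit_preimageM i : multiplicative_set (unit_preimage i).
Proof.
split=> [|U0|s t Us Ut]; rewrite /unit_preimage /=.
- by rewrite !rmorph1; exact: units1.
- apply: (units_nilpotentF U0); exists 1%N.
  by rewrite expr1 !rmorph0.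
- by rewrite !rmorphM; exact: unitsM.
Qed.

Lemma idem_fraction i : exists e c a, [/\ p i e = 1, forall j, j != i -> p j e = 0,
  forall q, e * q = q * e, units Q (f c) & f c * e = f a].
Proof.
have [e [ei eo ec]] := product_idem i; have [c [a [uc ca]]] := fracP e.
by exists e, c, a.
Qed.

Lemma unit_preimage_denominator i : left_denominator_set (unit_preimage i).
Proof.
have [e [c [a [ei eo ec uc ca]]]] := idem_fraction i.
have Ua : unit_preimage i a.
  by rewrite /unit_preimage /= -ca rmorphM ei mulr1; exact: units_proj.
split; first split; first exact: unit_preimageM.
- move=> r s [v [sv vs]]; have [w pw] := product_proj_surj v.
  have ews : e * w * f s = e.
    apply: product_inj => j; rewrite !rmorphM.
    have [->|ji] := eqVneq j i; first by rewrite pw -mulrA vs mulr1.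
    by rewrite eo // !mul0r.
  (* Here [e * w] is a left inverse of [f s] up to [e]. As [e] is central and [f a = f c * e],
     clearing the denominator [d] yields [d * a * r = b * s], the Ore condition. *)
  have [d [b [ud db]]] := fracP (f c * f r * (e * w)).
  exists (d * a), b; split.
    rewrite /unit_preimage /= !rmorphM; apply: unitsM => //.
    exact: units_proj.
  apply: f_inj; rewrite !rmorphM -db -ca -!mulrA; congr (_ * (_ * _)).
  by rewrite ec -[in LHS]ews !mulrA.
- move=> r s [v [sv vs]] rs; exists a => //.
  apply: f_inj; rewrite rmorphM -ca rmorph0 -mulrA.
  (* Multiplying by [e] leaves only factor [i], where [f s] is invertible and [r * s = 0] forces [r]
     to vanish. *)
  suff -> : e * f r = 0 by rewrite mulr0.
  apply: product_inj => j; rewrite rmorphM rmorph0.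
  have [->|ji] := eqVneq j i; last by rewrite eo // mul0r.
  by rewrite ei mul1r -[LHS]mulr1 -sv mulrA -!rmorphM rs !rmorph0 mul0r.
Qed.

(** The numerator [a] of the [i]-th idempotent separates the two sets: it is a unit in factor [i]
    and zero in all others. *)
Lemma unit_preimage_sub i j : unit_preimage i `<=` unit_preimage j -> i = j.
Proof.
have [e [c [a [ei eo ec uc ca]]]] := idem_fraction i.
move=> /(_ a) Uij; apply/eqP/negPn/negP => ij.
have : unit_preimage j a.
  apply: Uij; rewrite /unit_preimage /= -ca rmorphM ei mulr1.
  exact: units_proj.
rewrite /unit_preimage /= -ca rmorphM eo 1?eq_sym // mulr0.
by move=> /units_nilpotentF; apply; exists 1%N; rewrite expr1.
Qed.

Lemma multiplicative_sub_unit_preimage T :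
  multiplicative_set T -> exists i, T `<=` unit_preimage i.
Proof.
move=> [T1 T0 TM]; apply: contrapT => noi; apply: T0.
have killi i : exists2 t, T t & p i (f t) = 0.
  have [t [Tt nUt]] : exists t, T t /\ ~ unit_preimage i t.
    apply: contrapT => H; apply: noi; exists i => t Tt.
    by apply: contrapT => nUt; apply: H; exists t.
  have [k tk] := factor_nonunit nUt; exists (t ^+ k); last by rewrite !rmorphXn.
  by elim: k {tk} => [|k IH]; rewrite ?expr0 // exprS; exact: TM.
have kills (s : seq 'I_n) : exists2 t, T t & forall i, i \in s -> p i (f t) = 0.
  elim: s => [|i s [t Tt ts]]; first by exists 1.
  have [u Tu ui] := killi i; exists (u * t); first exact: TM.
  move=> j; rewrite inE !rmorphM => /predU1P[->|/ts ->]; last by rewrite mulr0.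
  by rewrite ui mul0r.
have [t Tt tz] := kills (enum 'I_n).
suff <- : t = 0 by [].
apply: f_inj; apply: product_inj => i; rewrite tz ?mem_enum //.
by rewrite !rmorph0.
Qed.

Lemma max_Den_preimage : max_Den R = [set S | exists i, S = unit_preimage i].
Proof.
apply/seteqP; split=> [S [dS Smax]|_ [i ->]].
  have [[mS _] _] := dS; have [i Si] := multiplicative_sub_unit_preimage mS.
  by exists i; rewrite -(Smax _ (unit_preimage_denominator i) Si).
split=> [|T [[mT _] _] iT]; first exact: unit_preimage_denominator.
have [j Tj] := multiplicative_sub_unit_preimage mT.
(* [T] is squeezed between the preimages for [i] and [j], which must then coincide. *)
have ij := unit_preimage_sub (subset_trans iT Tj).
by apply/seteqP; split=> //; rewrite ij.
Qed.

Lemma left_localizable_preimage r :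
  left_localizable R r <-> exists i, units (Ri i) (p i (f r)).
Proof.
split=> [[S [[mS _] _] Sr]|[i Ui]].
  by have [i Si] := multiplicative_sub_unit_preimage mS; exists i; exact: Si.
by exists (unit_preimage i); first exact: unit_preimage_denominator.
Qed.

Lemma nilpotents_preimage : nilpotents R = f @^-1` nilpotents Q.
Proof.
apply/seteqP; split=> r [k rk]; exists k.
  by rewrite -rmorphXn rk rmorph0.
by apply: f_inj; rewrite rmorphXn rk rmorph0.
Qed.

Lemma nil_radical_preimage : nil_radical R = nilpotents R.
Proof.
apply: nil_radicalE; rewrite nilpotents_preimage.
have [[N0 ND NM] NMr] := ideal_nilpotents_product.
split; first split.
- by rewrite /= rmorph0.
- by move=> x y Nx Ny; rewrite /= rmorphD; exact: ND.
- by move=> r x Nx; rewrite /= rmorphM; exact: NM.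
- by move=> r x Nx; rewrite /= rmorphM; exact: NMr.
Qed.

End Product.

(** * Left localizable elements of the product itself *)

Section ProductIdentity.
Variables (Q : nzRingType) (n : nat) (Ri : 'I_n -> nzRingType).
Variable p : forall i, {rmorphism Q -> Ri i}.
Hypothesis dec : local_nil_decomposition p.

Lemma left_localizable_product q :
  left_localizable Q q <-> exists i, units (Ri i) (p i q).
Proof.
have [_ pP loc] := dec.
apply: (left_localizable_preimage pP loc (f := idfun)) => // x.
by exists 1, x; split; [exact: units1 | rewrite mul1r].
Qed.

Lemma weakly_left_localizable_product : weakly_left_localizable Q.
Proof.
have [_ pP loc] := dec.
move=> q nq; apply/left_localizable_product; apply: contrapT => H.
apply: nq; apply/(nilpotents_productE pP loc) => i Ui; apply: H; by exists i.
Qed.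

End ProductIdentity.

(** If [ass T] is zero, elements of [T] are left regular; the denominator condition turns
    [x * t = 0] into [u * x = 0] with [u] in [T], so they are right regular too. *)
Lemma regulars_Sl0 (R : nzRingType) :
  left_denominator_set (regulars R) -> is_Sl0 (regulars R).
Proof.
move=> dR; split=> // [|T [_ Trev] aT t Tt].
  apply/seteqP; split=> [r [s [ls _] sr]|r ->].
    by apply: ls; rewrite sr mulr0.
  by exists 1; rewrite ?mulr0 //; case: dR => [[[]]].
have ann0 s r : T s -> s * r = 0 -> r = 0.
  by move=> Ts sr; have : ass T r by [exists s]; rewrite aT.
split=> x y /eqP; rewrite -subr_eq0 -?mulrBr -?mulrBl => /eqP xy;
  apply/eqP; rewrite -subr_eq0; apply/eqP.
  exact: ann0 xy.
by have [u Tu] := Trev _ _ Tt xy; exact: ann0.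
Qed.

(** * The classical left quotient ring *)

Section ClassicalQuotient.
Variables (R Q : nzRingType) (f : {rmorphism R -> Q}).
Hypothesis hQ : is_Qlcl f.

Lemma Qlcl_inj : injective f.
Proof.
have [_ [_ fker _]] := hQ.
move=> x y xy; apply/eqP; rewrite -subr_eq0; apply/eqP.
have /fker[s [ls _] sx] : f (x - y) = 0 by rewrite rmorphB xy subrr.
by apply: ls; rewrite sx mulr0.
Qed.

Lemma Qlcl_fraction q :
  exists c a, [/\ regulars R c, units Q (f c) & f c * q = f a].
Proof.
have [_ [_ _ /seteqP[_ /(_ q I)]]] := hQ.
move=> [c [a [u [Rc _ cu ->]]]]; exists c, a; have [cu1 uc1] := cu.
by split=> //; [exists u | rewrite mulrA cu1 mul1r].
Qed.

Lemma regulars_unitsE r : regulars R r <-> units Q (f r).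
Proof.
split; first by have [_ [fU _ _]] := hQ; exact: fU.
move=> [v [rv vr]]; split=> x y /(congr1 f); rewrite !rmorphM => xy.
  by apply: Qlcl_inj; rewrite -(mul1r (f x)) -vr -mulrA xy mulrA vr mul1r.
by apply: Qlcl_inj; rewrite -(mulr1 (f x)) -rv mulrA xy -mulrA rv mulr1.
Qed.

(** Common source of the two statements on fractions, applied to the nilpotent and to the left
    localizable elements of [Q]: multiplying by a denominator or its inverse does not leave [X]. *)
Lemma fractions_preimage (X : set Q) :
  (forall u q, units Q u -> X q -> X (u * q)) ->
  fractions f (regulars R) (f @^-1` X) = X.
Proof.
move=> XM; apply/seteqP; split=> [_ [s [x [u [_ Xx su ->]]]]|q Xq].
  by apply: XM => //; exact: inverse_units su.
have [c [a [Rc uc e]]] := Qlcl_fraction q; have [u [cu uc1]] := uc.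
exists c, a, u; split=> //=; first by rewrite -e; exact: XM.
by rewrite -e mulrA uc1 mul1r.
Qed.

End ClassicalQuotient.

(** * The six assertions assembled *)

Theorem corollary3p10
  (R : nzRingType) (hA : typeA R)
  (Q : nzRingType) (f : {rmorphism R -> Q}) (hQ : is_Qlcl f)
  (n : nat) (Ri : 'I_n -> nzRingType) (p : forall i, {rmorphism Q -> Ri i})
  (hp : local_nil_decomposition p) :
  max_Den R = [set S | exists i : 'I_n, S = [set r | units (Ri i) (p i (f r))]]
  /\ regulars R = completely_left_localizable R
  /\ nilpotents R = nil_radical R
  /\ (is_Ql f /\ weakly_left_localizable Q /\
      nilpotents Q = nil_radical Q /\ nil_radical Q = jacobson_radical Q)
  /\ (fractions f (regulars R) (nil_radical R) = nil_radical Q /\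
      nil_radical Q = jacobson_radical Q /\
      nil_radical R = f @^-1` (nil_radical Q))
  /\ (fractions f (regulars R) (left_localizable R) = left_localizable Q /\
      left_localizable R = f @^-1` (left_localizable Q)).
Proof.
have [_ pP loc] := hp; have f_inj := Qlcl_inj hQ.
have fracP q : exists c a, units Q (f c) /\ f c * q = f a.
  by have [c [a [_ uc e]]] := Qlcl_fraction hQ q; exists c, a.
have maxE := max_Den_preimage pP loc f_inj fracP.
have idN := ideal_nilpotents_product pP loc.
have nilQ := nil_radicalE idN.
have nilR := nil_radical_preimage pP loc f_inj.
have nilRQ := nilpotents_preimage f_inj.
have jacQ := jacobson_productE pP loc.
have locRQ : left_localizable R = f @^-1` left_localizable Q.
  apply/seteqP; split=> r.
    by move=> /(left_localizable_preimage pP loc f_inj fracP)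
      /(left_localizable_product hp).
  by move=> /(left_localizable_product hp)
    /(left_localizable_preimage pP loc f_inj fracP).
split; first exact: maxE.
split.
  (* Regular in [R] means invertible in [Q], that is, invertible in every factor, that is, in every
     maximal left denominator set. *)
  apply/seteqP; split=> r.
    move=> /(regulars_unitsE hQ) ur S; rewrite maxE => -[i ->].
    exact: units_proj.
  move=> Cr; apply/(regulars_unitsE hQ)/(units_product pP) => i.
  by apply: (Cr (unit_preimage p f i)); rewrite maxE; exists i.
split; first by rewrite nilR.
split.
  split; first by exists (regulars R) => //; apply: regulars_Sl0; case: hQ.
  by rewrite nilQ jacQ; split; first exact: weakly_left_localizable_product hp.
split.
  rewrite nilR nilQ jacQ nilRQ; split=> //; apply: fractions_preimage => //.
  by move=> u q _; have [[_ _ NM] _] := idN; exact: NM.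
split=> //; rewrite locRQ; apply: fractions_preimage => // u q uu.
move=> /(left_localizable_product hp)[i Ui].
apply/(left_localizable_product hp); exists i; rewrite rmorphM.
by apply: unitsM => //; exact: units_proj.
Qed.
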